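(* Let $n$ be a positive integer. Define a double-indexed sequence $H_r(k)$ (integers $r\ge 0$, $k\ge 0$) by $H_r(0)=1$ for all $r$ and, for $k\ge 1$, $$H_r(k)=(n-r-k)\,H_r(k-1)+2\,(n-2r-\delta(n-1))\,H_{r+1}(k-1).$$ Then $$L(n)=\frac{H_0(\lfloor n/2\rfloor)}{(n-1)(n-2)\cdots(n-\lfloor n/2\rfloor)},$$ where $L$ is the Lucas sequence defined by $L(0)=2$, $L(1)=1$, $L(m+1)=L(m)+L(m-1)$.
   Context: For an integer $m\ge 0$, $\delta(m)\in\{0,1\}$ is the residue of $m$ modulo $2$. The denominator is $\prod_{j=1}^{\lfloor n/2\rfloor}(n-j)$; an empty product equals $1$. *)

(* Defs.v *)
From mathcomp Require Import all_boot all_order all_algebra.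
Set Implicit Arguments.
Unset Strict Implicit.
Unset Printing Implicit Defensive.

Import GRing.Theory.
Local Open Scope ring_scope.

Definition delta (m : nat) : nat := (m %% 2)%N.

Fixpoint lucas (m : nat) : nat :=
  match m with
  | 0 => 2
  | 1 => 1
  | (m'.+1 as p).+1 => (lucas p + lucas m')%N
  end.

(* [H n r k] is H_r(k) for the given n. The differences are taken in [int]
   because the coefficients may be negative; only n - 1 inside [delta] is a
   (truncated) natural subtraction, which is exact for n > 0. *)
Fixpoint H (n r k : nat) : int :=
  match k with
  | 0 => 1
  | k'.+1 =>
      (n%:Z - r%:Z - k%:Z) * H n r k'
      + 2 * (n%:Z - 2 * r%:Z - (delta (n - 1))%:Z) * H n r.+1 k'
  end.

(* Main.v *)
Require Import Defs.
From mathcomp Require Import all_boot all_order all_algebra.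
From mathcomp Require Import zify ring.
Import GRing.Theory.
Local Open Scope ring_scope.

(** The recursion for [H] is a sum over lattice paths: each of the [k] steps
    either keeps [r] or raises it by one. After [s] steps of the first kind and
    [i] of the second, keeping [r] has weight [n - r - k + s], because the
    losses in [r] and in [k] compensate, and raising it has weight
    [2 (d - 2r - 2i)] with [d = n - delta (n - 1)]. So the weight of a path
    depends only on the number [j] of raising steps, and [H n r k] is a single
    binomial sum ([H_binomial_sum]).

    For [r = 0] and [k = m = n./2], the number [d] is the largest odd number up
    to [n]. The factors [2 (m - i)] of [2 ^ j * m ^_ j] and the factors [d - 2i]
    therefore interleave into the falling factorial [n ^_ (2j)]
    ([ffact_even_odd]), and the term of index [j], divided by the product of
    the [n - i] for [1 <= i <= m], becomes
    [n ^_ (2j) / (j! (n - 1) ^_ j) = n / (n - j) * 'C(n - j, j)]. This is the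
    number of [j]-edge matchings of a cycle of length [n]
    ([lucas_coef_ffact]), and these numbers add up to the Lucas number
    ([lucas_sum]). *)

Local Open Scope nat_scope.

(** The number of [j]-edge matchings of a cycle of length [n > 2]: the first
    summand counts those that avoid a chosen edge, the second those that contain it. *)
Definition lucas_coef (n j : nat) : nat :=
  'C(n - j, j) + (if j is i.+1 then 'C((n - j).-1, i) else 0).

(** A diagonal of Pascal's triangle, that is, the Fibonacci number of index
    [n + 1]. *)
Definition pascal_diag (n : nat) : nat := \sum_(j < n.+1) 'C(n - j, j).

Lemma pascal_diagSS n :
  pascal_diag n.+2 = pascal_diag n.+1 + pascal_diag n.
Proof.
rewrite /pascal_diag big_ord_recl big_ord_recr /= subnn bin0n addn0.
rewrite [X in _ = X + _]big_ord_recl /= !bin0 -addnA -big_split /=.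
congr (_ + _); apply: eq_bigr => i _.
have le_in : i <= n by rewrite -ltnS.
by rewrite /bump /= !add1n !subSS subSn // binS.
Qed.

Lemma pascal_diag_half n : pascal_diag n = \sum_(j < n./2.+1) 'C(n - j, j).
Proof.
rewrite /pascal_diag -(big_mkord xpredT (fun j => 'C(n - j, j))).
rewrite (@big_cat_nat _ _ _ n./2.+1) //=; last by lia.
rewrite big_mkord [X in _ + X]big_nat_cond [X in _ + X]big1 ?addn0 //.
by move=> j /andP[/andP[lo hi] _]; rewrite bin_small //; lia.
Qed.

Lemma lucas_pascal_diag n : lucas n.+2 = pascal_diag n.+2 + pascal_diag n.
Proof.
suff [] : lucas n.+2 = pascal_diag n.+2 + pascal_diag n /\
          lucas n.+3 = pascal_diag n.+3 + pascal_diag n.+1 by [].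
elim: n => [|n [IH1 IH2]].
  by rewrite /pascal_diag !big_ord_recr !big_ord0.
split=> //; rewrite -[lucas n.+4]/(lucas n.+3 + lucas n.+2) IH1 IH2.
rewrite (pascal_diagSS n.+2) (pascal_diagSS n); lia.
Qed.

Lemma lucas_sum n : 0 < n -> lucas n = \sum_(j < n./2.+1) lucas_coef n j.
Proof.
case: n => [//|[_|n _]]; first by rewrite big_ord_recr big_ord0.
rewrite lucas_pascal_diag !pascal_diag_half /lucas_coef big_split /=.
congr (_ + _); rewrite [RHS]big_ord_recl add0n.
by apply: eq_bigr => i _; rewrite lift0 subSS subSKn.
Qed.

(** The second summand of [lucas_coef n j] is the first one times
    [j / (n - j)], so that [lucas_coef n j = n / (n - j) * 'C(n - j, j)]. *)
Lemma mul_lucas_coef n j :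
  j < n -> (n - j) * lucas_coef n j = n * 'C(n - j, j).
Proof.
rewrite /lucas_coef; case: j => [|j] ltjn; first by rewrite subn0 addn0.
rewrite mulnDr mul_bin_diag -mulnDl.
by rewrite subnK // ltnW.
Qed.

Lemma ffactD n i j : n ^_ (i + j) = n ^_ i * (n - i) ^_ j.
Proof.
elim: j => [|j IH]; first by rewrite addn0 ffactn0 muln1.
by rewrite addnS !ffactnSr IH subnDA mulnA.
Qed.

Lemma lucas_coef_ffact n j :
  j < n -> j`! * (n.-1 ^_ j * lucas_coef n j) = n ^_ j.*2.
Proof.
move=> ltjn; have nj_gt0 : 0 < n - j by rewrite subn_gt0.
apply/eqP; rewrite -(eqn_pmul2l nj_gt0) -addnn ffactD.
rewrite -(bin_ffact (n - j)) mulnC -mulnA -[X in j`! * X]mulnA.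
rewrite [lucas_coef n j * _]mulnC mul_lucas_coef //.
have -> : n.-1 ^_ j * (n * 'C(n - j, j)) = n ^_ j.+1 * 'C(n - j, j).
  by rewrite ffactnS; ring.
by apply/eqP; rewrite ffactnSr; ring.
Qed.

Local Open Scope ring_scope.

Lemma sum_binS (V : nmodType) (f : nat -> V) k :
  \sum_(j < k.+2) f j *+ 'C(k.+1, j) =
  \sum_(j < k.+1) f j *+ 'C(k, j) + \sum_(j < k.+1) f j.+1 *+ 'C(k, j).
Proof.
have -> : \sum_(j < k.+1) f j *+ 'C(k, j) = \sum_(j < k.+2) f j *+ 'C(k, j).
  by rewrite [RHS]big_ord_recr /= bin_small // mulr0n addr0.
rewrite big_ord_recl [X in _ = X + _]big_ord_recl /= !bin0 -addrA -big_split /=.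
by congr (_ + _); apply: eq_bigr => j _; rewrite /bump /= add1n binS mulrnDr.
Qed.

(** The summand of index [j] collects the ['C(k, j)] lattice paths that raise
    [r] in [j] of their [k] steps. In the induction on [k], Pascal's rule
    distinguishes these paths by their first step, whose weight is either the
    factor [s = 0] of the first product or the factor [i = 0] of the second. *)
Lemma H_binomial_sum n r k :
  H n r k = \sum_(j < k.+1)
    (\prod_(s < k - j) (n%:Z - r%:Z - k%:Z + s%:Z) *
     \prod_(i < j) (2 * (n%:Z - 2 * (r + i)%:Z - (delta (n - 1))%:Z)))
      *+ 'C(k, j).
Proof.
elim: k r => [|k IH] r; first by rewrite big_ord1 /= subnn !big_ord0 mulr1.
rewrite [RHS](sum_binS _ (fun j =>
  \prod_(s < k.+1 - j) (n%:Z - r%:Z - k.+1%:Z + s%:Z) *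
  \prod_(i < j) (2 * (n%:Z - 2 * (r + i)%:Z - (delta (n - 1))%:Z)))).
rewrite [LHS]/= !IH; congr (_ + _); rewrite big_distrr; apply: eq_bigr => j _.
  have le_jk : (j <= k)%N by rewrite -ltnS.
  rewrite /= mulrnAr mulrA (subSn le_jk) [in RHS]big_ord_recl /= addr0.
  by congr (_ * _ * _ *+ _); apply: eq_bigr => s _; rewrite /bump /= add1n; lia.
rewrite /= mulrnAr subSS [in RHS]big_ord_recl addn0 mulrCA.
congr (_ * (_ * _) *+ _); apply: eq_bigr => i _; first by lia.
by rewrite lift0 addnS.
Qed.

Lemma prod_ffact (a b : nat) :
  \prod_(s < b) (a.+1%:Z + s%:Z) = ((a + b) ^_ b)%:Z.
Proof.
elim: b => [|b IH]; first by rewrite big_ord0.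
by rewrite big_ord_recr IH addnS ffactSS /=; lia.
Qed.

(** The factors [2 (n./2 - i)] run downwards through the even numbers up to [n],
    and the factors [n - delta (n - 1) - 2i] through the odd ones; in alternation
    they are [n], [n - 1], [n - 2] and so on. *)
Lemma ffact_even_odd n j : (0 < n)%N ->
  (n./2 ^_ j)%:Z * \prod_(i < j) (2 * (n%:Z - 2 * i%:Z - (delta (n - 1))%:Z)) =
  (n ^_ j.*2)%:Z.
Proof.
move=> n_gt0; elim: j => [|j IH]; first by rewrite big_ord0.
rewrite big_ord_recr /= doubleS !ffactnSr !PoszM -IH.
have [lejm|ltmj] := leqP j n./2; last by rewrite ffact_small // !mul0r.
rewrite -[RHS]mulrA; set P := \prod_(i < j) _; set F := (_ ^_ j)%:Z.
have -> : (n - j.*2)%:Z * (n - j.*2.+1)%:Z =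
          (n./2 - j)%:Z * (2 * (n%:Z - 2 * j%:Z - (delta (n - 1))%:Z)) :> int.
  have := odd_double_half n; rewrite /delta modn2; case: (odd n) => /=; nia.
by ring.
Qed.

(** Both sides agree term by term once [lucas n] is expanded by [lucas_sum]: with
    [m = n./2], the first product in the term of index [j] is
    [(n - 1 - j) ^_ (m - j)], which completes the factor [(n - 1) ^_ j] of
    [lucas_coef_ffact] to [(n - 1) ^_ m]. *)
Lemma H0_half n : (0 < n)%N ->
  H n 0 n./2 = (n.-1 ^_ n./2 * lucas n)%:Z.
Proof.
move=> n_gt0; rewrite H_binomial_sum lucas_sum // big_distrr /=.
rewrite (big_morph Posz PoszD (erefl _)); apply: eq_bigr => j _.
have le_jm : (j <= n./2)%N by rewrite -ltnS.
have lt_jn : (j < n)%N by lia.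
set Q := \prod_(i < j) _.
have binQ : 'C(n./2, j)%:Z * Q = (n.-1 ^_ j * lucas_coef n j)%:Z.
  have fact_neq0 : j`!%:Z != 0 by rewrite eqz_nat -lt0n fact_gt0.
  apply: (mulfI fact_neq0); rewrite mulrA -!PoszM [(_ * 'C(_, _))%N]mulnC.
  by rewrite bin_ffact lucas_coef_ffact // -ffact_even_odd.
have -> : \prod_(s < n./2 - j) (n%:Z - 0%:Z - n./2%:Z + s%:Z) =
          ((n.-1 - j) ^_ (n./2 - j))%:Z.
  have -> : (n.-1 - j = n.-1 - n./2 + (n./2 - j))%N by lia.
  by rewrite -prod_ffact; apply: eq_bigr => s _; lia.
rewrite -mulr_natr natz -mulrA [Q * _]mulrC binQ -PoszM.
have -> : (n.-1 ^_ n./2 = n.-1 ^_ j * (n.-1 - j) ^_ (n./2 - j))%N.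
  by rewrite -ffactD subnKC.
by congr Posz; ring.
Qed.

Theorem theorem7 (n : nat) (hn : (0 < n)%N) :
  ((lucas n)%:R : rat) =
    (H n 0 n./2)%:~R / \prod_(1 <= j < n./2.+1) (n%:R - j%:R).
Proof.
have -> : \prod_(1 <= j < n./2.+1) (n%:R - j%:R) = (n.-1 ^_ n./2)%:R :> rat.
  rewrite big_add1 big_mkord ffact_prod natr_prod; apply: eq_bigr => i _.
  have lt_im : (i < n./2)%N := ltn_ord i.
  rewrite -natrB; last by lia.
  by have -> : (n - i.+1 = n.-1 - i)%N by lia.
rewrite H0_half // PoszM intrM mulrAC divff ?mul1r //.
by rewrite intr_eq0 eqz_nat -lt0n ffact_gt0; lia.
Qed.
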